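(* Let $\Gamma$ be a Coxeter graph. Let $\widehat{PVA}[\Gamma]$ be the group with generators $\{\hat\zeta_\beta\mid\beta\in\Phi[\Gamma]\}$ and relations $Z(\gamma,\beta,\hat m_{\beta,\gamma})=Z(\beta,\gamma,\hat m_{\beta,\gamma})$ for all $\beta,\gamma\in\Phi[\Gamma]$ with $\beta\neq\gamma$ and $\hat m_{\beta,\gamma}\neq\infty$. Then the map $\hat\zeta_\beta\mapsto\zeta_\beta$ induces an isomorphism $\widehat{PVA}[\Gamma]\to PVA[\Gamma]$.
   Context: A Coxeter matrix on a countable set $S$ is a symmetric matrix $M=(m_{s,t})_{s,t\in S}$ with entries in $\mathbb{N}\cup\{\infty\}$ such that $m_{s,s}=1$ for all $s$ and $m_{s,t}=m_{t,s}\ge 2$ for $s\neq t$; it is encoded by a Coxeter graph $\Gamma$ with vertex set $S$ ($\Gamma$ is called finite if $S$ is finite). For letters $a,b$ and an integer $m\ge 2$, $\Pi_L(a,b,m)$ denotes the alternating word $aba\cdots$ of length $m$ beginning with $a$, and $\Pi_R(b,a,m)$ denotes the alternating word $\cdots aba$ of length $m$ ending with $a$; the same notation denotes the elements these words represent in a group. The Artin group $A[\Gamma]$ is given by the presentation $\langle S\mid \Pi_R(t,s,m_{s,t})=\Pi_R(s,t,m_{s,t})\text{ for } s\neq t,\ m_{s,t}\neq\infty\rangle$, and the Coxeter group $W[\Gamma]$ is the quotient of $A[\Gamma]$ by the relations $s^2=1$, $s\in S$. The virtual Artin group $VA[\Gamma]$ is the group generated by two sets $\{\sigma_s\mid s\in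 S\}$ and $\{\tau_s\mid s\in S\}$ in bijection with $S$, subject to the following relations, for all $s,t\in S$ with $s\neq t$ and $m_{s,t}\neq\infty$: (v1) $\Pi_R(\sigma_t,\sigma_s,m_{s,t})=\Pi_R(\sigma_s,\sigma_t,m_{s,t})$; (v2) $\Pi_R(\tau_t,\tau_s,m_{s,t})=\Pi_R(\tau_s,\tau_t,m_{s,t})$, together with $\tau_s^2=1$ for all $s\in S$; (v3) $\Pi_R(\tau_s,\tau_t,m_{s,t}-1)\,\sigma_s=\sigma_r\,\Pi_R(\tau_s,\tau_t,m_{s,t}-1)$, where $r=s$ if $m_{s,t}$ is even and $r=t$ if $m_{s,t}$ is odd. We have homomorphisms $\iota_A:A[\Gamma]\to VA[\Gamma]$, $s\mapsto\sigma_s$; $\iota_W:W[\Gamma]\to VA[\Gamma]$, $s\mapsto\tau_s$; $\pi_K:VA[\Gamma]\to W[\Gamma]$, $\sigma_s\mapsto 1$, $\tau_s\mapsto s$; and $\pi_P:VA[\Gamma]\to W[\Gamma]$, $\sigma_s\mapsto s$, $\tau_s\mapsto s$. Set $KVA[\Gamma]=\ker\pi_K$ and $PVA[\Gamma]=\ker\pi_P$. Let $V$ be the real vector space with basis $\{\alpha_s\mid s\in S\}$ (simple roots), with the canonical symmetric bilinear form $\langle\alpha_s,\alpha_t\rangle=-2\cos(\pi/m_{s,t})$ if $m_{s,t}\neq\infty$ and $=-2$ if $m_{s,t}=\infty$. $W[\Gamma]$ acts faithfully on $V$ by $s(v)=v-\langle v,\alpha_s\rangle\alpha_s$. The root system is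 $\Phi[\Gamma]=\{w(\alpha_s)\mid w\in W[\Gamma],s\in S\}$. For $\beta\in\Phi[\Gamma]$, $r_\beta\in W[\Gamma]$ is the reflection $v\mapsto v-\langle v,\beta\rangle\beta$. For $w\in W[\Gamma]$ and $g\in KVA[\Gamma]$ or $PVA[\Gamma]$ write $w\cdot g=\iota_W(w)g\iota_W(w)^{-1}$. For $\beta\in\Phi[\Gamma]$ choose $w\in W[\Gamma]$, $s\in S$ with $w(\alpha_s)=\beta$ and set $\delta_\beta=w\cdot\sigma_s\in KVA[\Gamma]$ and $\zeta_\beta=w\cdot(\tau_s\sigma_s)\in PVA[\Gamma]$ (these do not depend on the choice of $w,s$). Define the Coxeter matrix $\hat M=(\hat m_{\beta,\gamma})_{\beta,\gamma\in\Phi[\Gamma]}$ by $\hat m_{\beta,\beta}=1$, and for $\beta\neq\gamma$: $\hat m_{\beta,\gamma}=m_{s,t}$ if there exist $w\in W[\Gamma]$, $s,t\in S$ with $\beta=w(\alpha_s)$, $\gamma=w(\alpha_t)$, $m_{s,t}\neq\infty$ (this value is independent of choices), and $\hat m_{\beta,\gamma}=\infty$ otherwise. $\hat\Gamma$ is the Coxeter graph of $\hat M$ (vertex set $\Phi[\Gamma]$). For $\beta,\gamma\in\Phi[\Gamma]$ with $\hat m_{\beta,\gamma}=m\neq\infty$, define roots $\beta_1=\beta$ and for $2\le k\le m$: $\beta_k=\Pi_R(r_\gamma,r_\beta,k-1)(\gamma)$ if $k$ is even, $\beta_k=\Pi_R(r_\beta,r_\gamma,k-1)(\beta)$ if $k$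 is odd; and let $Z(\gamma,\beta,m)$ be the word $\hat\zeta_{\beta_m}\cdots\hat\zeta_{\beta_2}\hat\zeta_{\beta_1}$ over an abstract alphabet $\{\hat\zeta_\beta\mid\beta\in\Phi[\Gamma]\}$ in bijection with $\Phi[\Gamma]$. ($Z(\beta,\gamma,m)$ is defined by exchanging $\beta$ and $\gamma$.) *)

(* Defs.v *)
From Stdlib Require Import Reals ClassicalEpsilon.
From mathcomp Require Import all_boot.

Set Implicit Arguments.
Unset Strict Implicit.
Unset Printing Implicit Defensive.

(* A word over an alphabet X: letters x^{+1} (false) or x^{-1} (true). *)
Definition word (X : Type) := seq (bool * X).

Definition winv (X : Type) (u : word X) : word X :=
  rev (map (fun p => (~~ p.1, p.2)) u).

Definition pos_word (X : Type) (u : seq X) : word X := map (fun x => (false, x)) u.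

(* The congruence on words defining the group <X | rel>:
   two words are equal in <X | rel> iff they are related by [peq rel]. *)
Inductive peq (X : Type) (rel : word X -> word X -> Prop) : word X -> word X -> Prop :=
| peq_refl u : peq rel u u
| peq_sym u v : peq rel u v -> peq rel v u
| peq_trans u v w : peq rel u v -> peq rel v w -> peq rel u w
| peq_cat u u' v v' : peq rel u u' -> peq rel v v' -> peq rel (u ++ v) (u' ++ v')
| peq_free b x : peq rel [:: (b, x); (~~ b, x)] [::]
| peq_rel u v : rel u v -> peq rel u v.

Fixpoint piL (A : Type) (a b : A) (n : nat) : seq A :=
  match n with 0 => [::] | n'.+1 => a :: piL b a n' end.
Definition piR (A : Type) (b a : A) (n : nat) : seq A := rev (piL a b n).

(* ---------- Coxeter matrices (None encodes infinity) ---------- *)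

Definition coxeter_matrix (S : eqType) (M : S -> S -> option nat) : Prop :=
  (forall s, M s s = Some 1) /\ (forall s t, M s t = M t s) /\
  (forall s t m, s != t -> M s t = Some m -> 2 <= m).

Definition coxW_rel (S : eqType) (M : S -> S -> option nat) (u v : word S) : Prop :=
  (exists s, u = pos_word [:: s; s] /\ v = [::]) \/
  (exists s t m, s != t /\ M s t = Some m /\
     u = pos_word (piR t s m) /\ v = pos_word (piR s t m)).

Inductive vagen (S : Type) := Sig of S | Tau of S.

Definition VA_rel (S : eqType) (M : S -> S -> option nat) (u v : word (vagen S)) : Prop :=
  (exists s t m, s != t /\ M s t = Some m /\
     u = pos_word (piR (Sig t) (Sig s) m) /\ v = pos_word (piR (Sig s) (Sig t) m)) \/
  (exists s t m, s != t /\ M s t = Some m /\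
     u = pos_word (piR (Tau t) (Tau s) m) /\ v = pos_word (piR (Tau s) (Tau t) m)) \/
  (exists s, u = pos_word [:: Tau s; Tau s] /\ v = [::]) \/
  (exists s t m, s != t /\ M s t = Some m /\
     u = pos_word (piR (Tau s) (Tau t) m.-1 ++ [:: Sig s]) /\
     v = pos_word (Sig (if odd m then t else s) :: piR (Tau s) (Tau t) m.-1)).

Definition piP_word (S : Type) (u : word (vagen S)) : word S :=
  map (fun p => (p.1, match p.2 with Sig s => s | Tau s => s end)) u.

Definition inPVA (S : eqType) (M : S -> S -> option nat) (u : word (vagen S)) : Prop :=
  peq (coxW_rel M) (piP_word u) [::].

Section Roots.
Variable S : countType.
Variable M : S -> S -> option nat.

Definition bil (s t : S) : R :=
  match M s t with
  | Some k => Rmult (Ropp (IZR 2%Z)) (cos (Rdiv PI (INR k)))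
  | None => (Ropp (IZR 2%Z))
  end.

(* vectors of V are finitely supported functions S -> R *)
Definition alpha (s : S) : S -> R := fun t => if t == s then R1 else R0.

(* a duplicate-free list containing the support of f (for finitely supported f) *)
Definition supp_list (f : S -> R) : seq S :=
  epsilon (inhabits [::]) (fun l => uniq l /\ forall t, t \notin l -> f t = R0).

Definition Rsum (l : seq R) : R := foldr Rplus R0 l.

Definition bform (f g : S -> R) : R :=
  Rsum (map (fun t => Rsum (map (fun u => Rmult (Rmult (f t) (g u)) (bil t u))
                                 (supp_list g))) (supp_list f)).

Definition refl (g : S -> R) (v : S -> R) : S -> R :=
  fun t => Rminus (v t) (Rmult (bform v g) (g t)).

Definition wact (w : seq S) (v : S -> R) : S -> R :=
  foldr (fun s x => refl (alpha s) x) v w.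

Definition is_root (f : S -> R) : Prop :=
  exists ws : seq S * S, f = wact ws.1 (alpha ws.2).

Definition Phi := {f : S -> R | is_root f}.

Definition mhat_is (b g : S -> R) (m : nat) : Prop :=
  exists w s t, b = wact w (alpha s) /\ g = wact w (alpha t) /\ M s t = Some m.

Definition applyseq (l : seq ((S -> R) -> (S -> R))) (v : S -> R) : S -> R :=
  foldr (fun r x => r x) v l.

Definition betak (g b : S -> R) (k : nat) : S -> R :=
  if odd k then applyseq (piR (refl b) (refl g) k.-1) b
  else applyseq (piR (refl g) (refl b) k.-1) g.

Definition Zletters (g b : S -> R) (m : nat) : seq (S -> R) :=
  [seq betak g b k | k <- rev (iota 1 m)].

Definition hat_rel (u v : word Phi) : Prop :=
  exists (b g : Phi) (m : nat),
    proj1_sig b <> proj1_sig g /\ mhat_is (proj1_sig b) (proj1_sig g) m /\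
    map (fun p => (p.1, proj1_sig p.2)) u = pos_word (Zletters (proj1_sig g) (proj1_sig b) m) /\
    map (fun p => (p.1, proj1_sig p.2)) v = pos_word (Zletters (proj1_sig b) (proj1_sig g) m).

Definition root_rep (f : S -> R) : option (seq S * S) :=
  epsilon (inhabits None)
    (fun o => match o with Some ws => f = wact ws.1 (alpha ws.2) | None => False end).

Definition tauw (w : seq S) : word (vagen S) := pos_word (map (@Tau S) w).

Definition zeta (f : S -> R) : word (vagen S) :=
  match root_rep f with
  | Some (w, s) => tauw w ++ pos_word [:: Tau s; Sig s] ++ winv (tauw w)
  | None => [::]
  end.

Definition hatmap (u : word Phi) : word (vagen S) :=
  flatten (map (fun p => if p.1 then winv (zeta (proj1_sig p.2)) else zeta (proj1_sig p.2)) u).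

End Roots.

(* Main.v *)
Require Import Defs.
From Stdlib Require Import Reals.
From mathcomp Require Import all_boot.
From Stdlib Require Import Lra Setoid Morphisms Classical ClassicalEpsilon FunctionalExtensionality.

(** VA is the semidirect product PVA x| W. An explicit cocycle VA -> hat PVA, namely the
    first component of the morphism VA -> hat PVA x| W with tau_s |-> (1, s) and
    sigma_s |-> (hat zeta_{-a_s}, s), inverts the map hat PVA -> PVA. That it respects the
    relations of VA follows because the word Z(a_t, a_s, m) is obtained by moving all the
    tau's of (tau_s tau_t ...)(... sigma_t sigma_s) to one side.
    The conjugate w . (tau_s sigma_s) depends only on the root w a_s because an element of W
    carrying a simple root to a simple root is a product of elements Pi_R(s, t, m - 1) which
    do so, and for these the relation (v3) applies. *)

Set Implicit Arguments.
Unset Strict Implicit.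
Unset Printing Implicit Defensive.

Delimit Scope R_scope with real.

(** * Groups given by presentations *)

#[local] Hint Resolve peq_refl : core.

#[local] Instance peq_equivalence X (rel : word X -> word X -> Prop) : Equivalence (peq rel).
Proof. split; [exact: peq_refl | exact: peq_sym | exact: peq_trans]. Qed.

#[local] Instance cat_peq_proper X (rel : word X -> word X -> Prop) :
  Proper (peq rel ==> peq rel ==> peq rel) (@cat (bool * X)).
Proof. by move=> u u' uu' v v' vv'; apply: peq_cat. Qed.

#[local] Instance cons_peq_proper X (rel : word X -> word X -> Prop) (x : bool * X) :
  Proper (peq rel ==> peq rel) (cons x).
Proof. by move=> u v; apply: (peq_cat (peq_refl _ [:: x])). Qed.

Lemma winv_cons X (x : bool * X) (u : word X) : winv (x :: u) = winv u ++ [:: (~~ x.1, x.2)].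
Proof. by rewrite /winv /= rev_cons -cats1. Qed.

Lemma winv_cat X (u v : word X) : winv (u ++ v) = winv v ++ winv u.
Proof. by rewrite /winv map_cat rev_cat. Qed.

Lemma winvK X (u : word X) : winv (winv u) = u.
Proof.
rewrite /winv map_rev revK -map_comp -[RHS]map_id; apply: eq_map => -[b x] /=.
by rewrite negbK.
Qed.

Lemma pos_word_cat X (u v : seq X) : pos_word (u ++ v) = pos_word u ++ pos_word v.
Proof. exact: map_cat. Qed.

Section PresentedGroup.
Variables (X : Type) (rel : word X -> word X -> Prop).
Notation "u ≡ v" := (peq rel u v) (at level 70).

Lemma peq_mulV u : u ++ winv u ≡ [::].
Proof.
elim: u => [|[b x] u IH]; first exact: peq_refl.
rewrite winv_cons -[_ :: u]cat1s -catA (catA u) IH; exact: peq_free.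
Qed.

Lemma peq_Vmul u : winv u ++ u ≡ [::].
Proof. by have := peq_mulV (winv u); rewrite winvK. Qed.

Lemma peq_mulVK u v : winv u ++ u ++ v ≡ v.
Proof. by rewrite catA peq_Vmul. Qed.

Lemma peq_cancel_l u v w : u ++ v ≡ u ++ w -> v ≡ w.
Proof. by move=> H; rewrite -(peq_mulVK u v) H peq_mulVK. Qed.

Lemma peq_cancel_r u v w : v ++ u ≡ w ++ u -> v ≡ w.
Proof.
by move=> H; rewrite -(cats0 v) -(cats0 w) -(peq_mulV u) !catA H.
Qed.

Lemma peq_winv u v : u ≡ v -> winv u ≡ winv v.
Proof. by move=> uv; apply: (@peq_cancel_l u); rewrite peq_mulV uv peq_mulV. Qed.

Lemma peq_winvP u v : u ++ v ≡ [::] -> v ≡ winv u.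
Proof. by move=> H; apply: (@peq_cancel_l u); rewrite H peq_mulV. Qed.

End PresentedGroup.

Lemma piL_rcons (A : Type) (a b : A) k :
  piL a b k.+1 = rcons (piL a b k) (if odd k then b else a).
Proof.
elim: k a b => // k IH a b.
by rewrite [LHS]/= -/(piL b a k.+1) IH /= if_neg.
Qed.

Lemma piR_cons (A : Type) (a b : A) k :
  piR b a k.+1 = (if odd k then b else a) :: piR b a k.
Proof. by rewrite /piR piL_rcons rev_rcons. Qed.

Lemma piR_rcons (A : Type) (a b : A) k : piR b a k.+1 = rcons (piR a b k) a.
Proof. by rewrite /piR /= rev_cons. Qed.

(** The last letter is always [a], so the parity of [k] decides the first one. *)
Lemma piRE (A : Type) (a b : A) k :
  piR b a k = if odd k then piL a b k else piL b a k.
Proof.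
elim: k => // k IH; rewrite piR_cons IH /=; by case: (odd k).
Qed.

Lemma map_piL (A B : Type) (f : A -> B) a b k : map f (piL a b k) = piL (f a) (f b) k.
Proof. by elim: k a b => //= k IH a b; rewrite IH. Qed.

Lemma map_piR (A B : Type) (f : A -> B) a b k : map f (piR a b k) = piR (f a) (f b) k.
Proof. by rewrite /piR map_rev map_piL. Qed.

Lemma size_piL (A : Type) (a b : A) k : size (piL a b k) = k.
Proof. by elim: k a b => //= k IH a b; rewrite IH. Qed.

Lemma size_piR (A : Type) (a b : A) k : size (piR a b k) = k.
Proof. by rewrite size_rev size_piL. Qed.

(** * The geometric representation *)

(** Vectors are bare functions, so linearity is phrased with two-term combinations; a multiple of
    one vector takes 0 as second coefficient. *)
Definition lc (S : Type) (a : R) (f : S -> R) (b : R) (g : S -> R) : S -> R :=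
  fun t => (a * f t + b * g t)%real.

(** The vectors of V: only for them does [supp_list] satisfy its specification, hence the side
    conditions on [bform] and [refl]. *)
Definition finsupp (S : eqType) (f : S -> R) : Prop :=
  exists l : seq S, forall t, t \notin l -> f t = R0.

(** * Finite sums over lists *)

Section FiniteSums.
Variable S : eqType.
Implicit Types (h : S -> R) (l : seq S).

Lemma Rsum_filter h l (p : pred S) :
  (forall t, ~~ p t -> h t = R0) -> Rsum (map h (filter p l)) = Rsum (map h l).
Proof.
move=> hp; elim: l => //= t l IH; case: ifP => pt /=; first by rewrite IH.
by rewrite IH hp ?pt //; lra.
Qed.

Lemma Rsum_perm (l1 l2 : seq S) h : perm_eq l1 l2 -> Rsum (map h l1) = Rsum (map h l2).
Proof.
move=> /(@catCA_perm_ind S (fun l => Rsum (map h l1) = Rsum (map h l))); apply => //.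
move=> a b c ->.
have Rsum_cat u v : Rsum (map h (u ++ v)) = (Rsum (map h u) + Rsum (map h v))%real.
  by elim: u => [|x u IH] /=; [lra|rewrite IH; lra].
by rewrite !Rsum_cat; lra.
Qed.

(** Filtering each list by membership in the other drops only zero terms and leaves the same
    elements. *)
Lemma Rsum_supp h l1 l2 : uniq l1 -> uniq l2 ->
  (forall t, t \notin l1 -> h t = R0) -> (forall t, t \notin l2 -> h t = R0) ->
  Rsum (map h l1) = Rsum (map h l2).
Proof.
move=> u1 u2 h1 h2.
rewrite -(Rsum_filter l1 h2) -(Rsum_filter l2 h1).
apply: Rsum_perm; apply: uniq_perm; rewrite ?filter_uniq //.
by move=> t; rewrite !mem_filter andbC.
Qed.

Lemma eq_Rsum h1 h2 l : h1 =1 h2 -> Rsum (map h1 l) = Rsum (map h2 l).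
Proof. by move=> e; rewrite (eq_map e). Qed.

Lemma Rsum_lc h1 h2 a b l :
  Rsum (map (lc a h1 b h2) l) = (a * Rsum (map h1 l) + b * Rsum (map h2 l))%real.
Proof. by elim: l => [|t l IH] /=; rewrite ?IH /lc; lra. Qed.

Lemma Rsum0 l : Rsum (map (fun=> R0) l) = R0.
Proof. by elim: l => //= t l ->; lra. Qed.

Lemma Rsum_exchange (h : S -> S -> R) l1 l2 :
  Rsum (map (fun t => Rsum (map (fun u => h t u) l2)) l1) =
  Rsum (map (fun u => Rsum (map (fun t => h t u) l1)) l2).
Proof.
elim: l1 => [|t l1 IH] /=; first by rewrite Rsum0.
rewrite IH.
have := Rsum_lc (h t) (fun u => Rsum (map (h^~ u) l1)) 1 1 l2.
by rewrite !Rmult_1_l => <-; apply: eq_Rsum => u; rewrite /lc; lra.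
Qed.

End FiniteSums.

(** * The bilinear form and the reflections *)

Section Form.
Variables (S : countType) (M : S -> S -> option nat).
Implicit Types (f g h v : S -> R) (s t : S) (w : seq S).

Lemma supp_listP f : finsupp f ->
  uniq (supp_list f) /\ forall t, t \notin supp_list f -> f t = R0.
Proof.
case=> l hl; refine (epsilon_spec (inhabits [::])
  (fun l => uniq l /\ forall t, t \notin l -> f t = R0) _); exists (undup l).
by split=> [|t]; rewrite ?undup_uniq // mem_undup; apply: hl.
Qed.

(** Frees the form from the supports picked by [epsilon]: any convenient lists may be used to
    compute it. *)
Lemma bformE f g l1 l2 : uniq l1 -> uniq l2 ->
  (forall t, t \notin l1 -> f t = R0) -> (forall t, t \notin l2 -> g t = R0) ->
  bform M f g = Rsum (map (fun t => Rsum (map (fun u => f t * g u * bil M t u)%real l2)) l1).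
Proof.
move=> u1 u2 h1 h2.
have [v1 k1] : uniq (supp_list f) /\ forall t, t \notin supp_list f -> f t = R0.
  by apply: supp_listP; exists l1.
have [v2 k2] : uniq (supp_list g) /\ forall t, t \notin supp_list g -> g t = R0.
  by apply: supp_listP; exists l2.
rewrite /bform.
rewrite (@eq_Rsum _ _ (fun t => Rsum (map (fun u => f t * g u * bil M t u)%real l2))).
  apply: Rsum_supp => // t tl.
    by rewrite k1 // -[RHS](Rsum0 l2); apply: eq_Rsum => u; lra.
  by rewrite h1 // -[RHS](Rsum0 l2); apply: eq_Rsum => u; lra.
by move=> t; apply: Rsum_supp => // u ul; [rewrite k2 // | rewrite h2 //]; lra.
Qed.

Lemma finsupp_alpha s : finsupp (alpha s).
Proof. by exists [:: s] => t; rewrite inE /alpha => /negbTE ->. Qed.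

Lemma finsupp_lc a f b g : finsupp f -> finsupp g -> finsupp (lc a f b g).
Proof.
move=> [l hl] [k hk]; exists (l ++ k) => t; rewrite mem_cat negb_or => /andP [tl tk].
by rewrite /lc hl // hk //; lra.
Qed.

Lemma reflE g v : refl M g v = lc 1 v (- bform M v g) g.
Proof. by apply: functional_extensionality => t; rewrite /refl /lc; lra. Qed.

Lemma finsupp_refl g v : finsupp g -> finsupp v -> finsupp (refl M g v).
Proof. by move=> fg fv; rewrite reflE; apply: finsupp_lc. Qed.

Lemma finsupp_wact w v : finsupp v -> finsupp (wact M w v).
Proof.
move=> fv; elim: w => //= s w IH; apply: finsupp_refl => //; exact: finsupp_alpha.
Qed.

#[local] Hint Resolve finsupp_alpha finsupp_lc finsupp_refl finsupp_wact : core.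

Lemma bform_lcl a f b g h : finsupp f -> finsupp g -> finsupp h ->
  bform M (lc a f b g) h = (a * bform M f h + b * bform M g h)%real.
Proof.
move=> [l hl] [k hk] fh; have [uh kh] := supp_listP fh.
set L := undup (l ++ k).
have hL t : t \notin L -> f t = R0 /\ g t = R0.
  by rewrite mem_undup mem_cat negb_or => /andP [/hl -> /hk ->].
rewrite !(@bformE _ _ L (supp_list h)) ?undup_uniq //.
- rewrite -Rsum_lc; apply: eq_Rsum => t; rewrite /lc -Rsum_lc; apply: eq_Rsum => u.
  by rewrite /lc; lra.
- by move=> t /hL [].
- by move=> t /hL [].
by move=> t /hL []; rewrite /lc => -> ->; lra.
Qed.

Lemma bform_alpha s t : bform M (alpha s) (alpha t) = bil M s t.
Proof.
rewrite (@bformE _ _ [:: s] [:: t]) //=.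
- by rewrite /alpha !eqxx; lra.
- by move=> u; rewrite inE /alpha => /negbTE ->.
by move=> u; rewrite inE /alpha => /negbTE ->.
Qed.

Hypothesis HM : coxeter_matrix M.

Lemma bilC s t : bil M s t = bil M t s.
Proof. by rewrite /bil HM.2.1. Qed.

Lemma bil_diag s : bil M s s = 2%real.
Proof. by rewrite /bil HM.1 /= Rdiv_1_r cos_PI; lra. Qed.

Lemma bformC f g : finsupp f -> finsupp g -> bform M f g = bform M g f.
Proof.
move=> /supp_listP [u1 k1] /supp_listP [u2 k2].
rewrite (@bformE f g _ _ u1 u2) // (@bformE g f _ _ u2 u1) // Rsum_exchange.
by apply: eq_Rsum => t; apply: eq_Rsum => u; rewrite bilC; lra.
Qed.

Lemma bform_lcr a f b g h : finsupp f -> finsupp g -> finsupp h ->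
  bform M h (lc a f b g) = (a * bform M h f + b * bform M h g)%real.
Proof.
move=> ff fg fh; rewrite bformC ?bform_lcl //; last exact: finsupp_lc.
by rewrite (bformC ff) // (bformC fg).
Qed.

Lemma refl_isometry b f g : finsupp b -> finsupp f -> finsupp g -> bform M b b = 2%real ->
  bform M (refl M b f) (refl M b g) = bform M f g.
Proof.
move=> fb ff fg b2; rewrite !reflE bform_lcl ?bform_lcr //; try exact: finsupp_lc.
by rewrite b2 (bformC fb fg); lra.
Qed.

Lemma reflK b v : finsupp b -> finsupp v -> bform M b b = 2%real -> refl M b (refl M b v) = v.
Proof.
move=> fb fv b2; rewrite !reflE bform_lcl // b2.
by apply: functional_extensionality => t; rewrite /lc; lra.
Qed.

Lemma refl_lc b x f y g : finsupp b -> finsupp f -> finsupp g ->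
  refl M b (lc x f y g) = lc x (refl M b f) y (refl M b g).
Proof.
move=> fb ff fg; rewrite !reflE bform_lcl //.
by apply: functional_extensionality => t; rewrite /lc; lra.
Qed.

Lemma bform_alpha2 s : bform M (alpha s) (alpha s) = 2%real.
Proof. by rewrite bform_alpha bil_diag. Qed.

Lemma wact_cat w1 w2 v : wact M (w1 ++ w2) v = wact M w1 (wact M w2 v).
Proof. exact: foldr_cat. Qed.

Lemma wact_lc w x f y g : finsupp f -> finsupp g ->
  wact M w (lc x f y g) = lc x (wact M w f) y (wact M w g).
Proof. by move=> ff fg; elim: w => //= s w ->; rewrite refl_lc; auto. Qed.

Lemma simple_reflK s v : finsupp v -> refl M (alpha s) (refl M (alpha s) v) = v.
Proof. by move=> fv; apply: reflK => //; exact: bform_alpha2. Qed.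

Lemma wact_revK w v : finsupp v -> wact M (rev w) (wact M w v) = v.
Proof.
move=> fv; elim: w => //= s w IH.
by rewrite rev_cons -cats1 wact_cat /= simple_reflK; auto.
Qed.

Lemma wactK w v : finsupp v -> wact M w (wact M (rev w) v) = v.
Proof. by move=> fv; rewrite -{1}(revK w) wact_revK. Qed.

Lemma wact_inj w f g : finsupp f -> finsupp g -> wact M w f = wact M w g -> f = g.
Proof. by move=> ff fg e; rewrite -(wact_revK w ff) e wact_revK. Qed.

Lemma wact_isometry w f g : finsupp f -> finsupp g ->
  bform M (wact M w f) (wact M w g) = bform M f g.
Proof.
by move=> ff fg; elim: w => //= s w IH; rewrite refl_isometry ?bform_alpha2; auto.
Qed.

(** The rule r_{wb} = w r_b w^{-1}, by which products of reflections in w a_s and w a_t reduce to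
    simple reflections. *)
Lemma refl_wact w b v : finsupp b -> finsupp v ->
  refl M (wact M w b) (wact M w v) = wact M w (refl M b v).
Proof. by move=> fb fv; rewrite !reflE wact_isometry // wact_lc. Qed.

Lemma refl_alpha_self s : refl M (alpha s) (alpha s) = (fun t => - alpha s t)%real.
Proof.
by rewrite reflE bform_alpha2; apply: functional_extensionality => t; rewrite /lc; lra.
Qed.

Lemma alpha_diag s : alpha s s = 1%real.
Proof. by rewrite /alpha eqxx. Qed.

Lemma alpha_off s t : s != t -> alpha s t = 0%real.
Proof. by rewrite /alpha eq_sym => /negbTE ->. Qed.

Lemma alpha_inj s t : alpha s = alpha t -> s = t.
Proof.
move=> e; case: (eqVneq s t) => // st; have := alpha_diag t.
by rewrite -e alpha_off //; lra.
Qed.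

End Form.

#[local] Hint Resolve finsupp_alpha finsupp_lc finsupp_refl finsupp_wact : core.

(** * Chebyshev polynomials at 2 cos(pi/m) *)

Fixpoint cheb (c : R) (k : nat) : R :=
  match k with
  | 0 => 0%real
  | k'.+1 => match k' with 0 => 1%real | k''.+1 => (c * cheb c k' - cheb c k'')%real end
  end.

Lemma chebSS c k : cheb c k.+2 = (c * cheb c k.+1 - cheb c k)%real.
Proof. by []. Qed.

(** In terms of the Chebyshev polynomials of the second kind, [cheb c k] is U_{k-1}(c/2); the
    recursion is the addition formula for the sine. *)
Lemma sin_cheb x k : (sin x * cheb (2 * cos x) k = sin (INR k * x))%real.
Proof.
suff: (sin x * cheb (2 * cos x) k = sin (INR k * x) /\
       sin x * cheb (2 * cos x) k.+1 = sin (INR k.+1 * x))%real by case.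
elim: k => [|k [IH1 IH2]].
  by rewrite /= Rmult_0_l sin_0 Rmult_1_l; lra.
split=> //; rewrite chebSS.
have -> : (INR k.+2 * x = INR k.+1 * x + x)%real by rewrite !S_INR; lra.
have E : (INR k * x = INR k.+1 * x - x)%real by rewrite !S_INR; lra.
move: IH1; rewrite E sin_minus sin_plus -IH2 => IH1.
by nra.
Qed.

(** Serves the label infinity, for which [- bil] equals 2. *)
Lemma cheb2 k : cheb 2 k = INR k.
Proof.
suff: (cheb 2 k = INR k /\ cheb 2 k.+1 = INR k.+1)%real by case.
elim: k => [|k [IH1 IH2]]; first by split.
by split=> //; rewrite chebSS IH1 IH2 !S_INR; lra.
Qed.

Section Trig.
Variable m : nat.
Hypothesis m2 : 2 <= m.
Let x := (PI / INR m)%real.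

Lemma INR_ge2 : (2 <= INR m)%real.
Proof. by apply: (le_INR 2); apply/leP. Qed.

Lemma pi_frac k : k < m -> (0 <= INR k * x < PI)%real.
Proof.
move=> km; have pi0 := PI_RGT_0; have hm := INR_ge2.
have hk : (INR k < INR m)%real by apply: lt_INR; apply/ltP.
have k0 := pos_INR k.
have e : (PI = INR m * x)%real by rewrite /x; field; lra.
have x0 : (0 < x)%real by apply: Rdiv_lt_0_compat; lra.
by split; nra.
Qed.

Lemma sin_pi_frac k : 0 < k -> k < m -> (0 < sin (INR k * x))%real.
Proof.
move=> k0 km; have [h1 h2] := pi_frac km.
have hk : (0 < INR k)%real by apply: lt_0_INR; apply/ltP.
have x0 : (0 < x)%real by apply: Rdiv_lt_0_compat; [exact: PI_RGT_0 | have := INR_ge2; lra].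
by apply: sin_gt_0 => //; nra.
Qed.

Lemma sin_pi_div : (0 < sin x)%real.
Proof. by have := @sin_pi_frac 1 isT m2; rewrite Rmult_1_l. Qed.

Lemma cheb_gt0 k : 0 < k -> k < m -> (0 < cheb (2 * cos x) k)%real.
Proof.
by move=> k0 km; have := sin_pi_frac k0 km; rewrite -sin_cheb; have := sin_pi_div; nra.
Qed.

Lemma INR_mx : (INR m * x = PI)%real.
Proof. by rewrite /x; field; have := INR_ge2; lra. Qed.

Lemma cheb_m : cheb (2 * cos x) m = 0%real.
Proof.
have := sin_cheb x m; rewrite INR_mx sin_PI; have := sin_pi_div.
by nra.
Qed.

Lemma cheb_pred : cheb (2 * cos x) m.-1 = 1%real.
Proof.
have h := sin_cheb x m.-1.
have e : (INR m.-1 * x = PI - x)%real.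
  by have := INR_mx; rewrite -{1}(prednK (ltnW m2)) S_INR; lra.
move: h; rewrite e sin_PI_x; have := sin_pi_div.
by nra.
Qed.

End Trig.

(** * The action of two simple reflections *)

Section Rank2.
Variables (S : countType) (M : S -> S -> option nat).
Hypothesis HM : coxeter_matrix M.
Implicit Types (v : S -> R) (s t : S).

Lemma lcC (T : Type) a (f : T -> R) b g : lc a f b g = lc b g a f.
Proof. by apply: functional_extensionality => t; rewrite /lc; lra. Qed.

Lemma refl_rank2 s t p q : s != t ->
  refl M (alpha s) (lc p (alpha t) q (alpha s)) =
  lc p (alpha t) (- bil M s t * p - q)%real (alpha s).
Proof.
move=> st; rewrite reflE bform_lcl // !bform_alpha bil_diag // (bilC HM t).
by apply: functional_extensionality => u; rewrite /lc; lra.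
Qed.

(** The next reflection is in the simple root with coefficient [cheb k]; it replaces this
    coefficient by [cheb k.+2] and keeps the other. *)
Lemma wact_rank2 s t k : s != t ->
  wact M (piR s t k) (alpha s) =
  lc (cheb (- bil M s t) k.+1) (alpha (if odd k then t else s))
     (cheb (- bil M s t) k) (alpha (if odd k then s else t)).
Proof.
move=> st; elim: k => [|k IH].
  by apply: functional_extensionality => u; rewrite /lc /=; lra.
rewrite piR_cons /= IH -/(cheb _ k.+2) chebSS; case: (odd k) => /=.
  by rewrite refl_rank2 // lcC.
by rewrite refl_rank2 1?eq_sym // lcC bilC.
Qed.

Lemma bil_fin s t m : M s t = Some m -> (- bil M s t = 2 * cos (PI / INR m))%real.
Proof. by rewrite /bil => ->; lra. Qed.

(** After m - 1 letters the coefficients are [cheb m] = 0 and [cheb m.-1] = 1. This is (v3) on the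
    level of roots. *)
Lemma wact_longest s t m : s != t -> M s t = Some m ->
  wact M (piR s t m.-1) (alpha s) = alpha (if odd m then t else s).
Proof.
move=> st mst; have m2 := HM.2.2 _ _ _ st mst.
rewrite wact_rank2 // (bil_fin mst).
rewrite (prednK (ltnW m2)) cheb_m // cheb_pred //.
rewrite -[in RHS](prednK (ltnW m2)) /= if_neg.
by apply: functional_extensionality => u; rewrite /lc; lra.
Qed.

(** Both sides give -a_r with a_r as in [wact_longest]: on the left the letter s negates a_s first,
    on the right the letter r negates a_r last. *)
Lemma wact_braid_alpha s t m : s != t -> M s t = Some m ->
  wact M (piR t s m) (alpha s) = wact M (piR s t m) (alpha s).
Proof.
case: m => // n st mst; have := wact_longest st mst; rewrite /= if_neg => L.
rewrite [in LHS]piR_rcons [in RHS]piR_cons -cats1 wact_cat /= L !refl_alpha_self //.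
have nE u : (fun y => - alpha u y)%real = lc (- 1) (alpha u) 0 (alpha u).
  by apply: functional_extensionality => y; rewrite /lc; lra.
by rewrite !nE wact_lc // L; apply: functional_extensionality => y; rewrite /lc; lra.
Qed.

Lemma wact_orthogonal (w : seq S) s t v : all (mem [:: s; t]) w -> finsupp v ->
  bform M v (alpha s) = 0%real -> bform M v (alpha t) = 0%real -> wact M w v = v.
Proof.
move=> aw fv vs vt; elim: w aw => //= u w IH /andP [ust /IH ->].
rewrite reflE; have -> : bform M v (alpha u) = 0%real.
  by move: ust; rewrite !inE => /orP [/eqP -> | /eqP ->].
by apply: functional_extensionality => y; rewrite /lc; lra.
Qed.

Lemma all_piR s t k : all (mem [:: s; t]) (piR s t k).
Proof. by elim: k => // k IH; rewrite piR_cons /= IH; case: (odd k); rewrite !inE eqxx ?orbT. Qed.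

(* The Gram determinant 4 sin^2 (pi/m) of the plane of a_s, a_t is nonzero, so this
   plane has an orthogonal complement, which both sides fix. *)
Lemma wact_braid s t m v : s != t -> M s t = Some m -> finsupp v ->
  wact M (piR t s m) v = wact M (piR s t m) v.
Proof.
move=> st mst fv; have m2 := HM.2.2 _ _ _ st mst.
have mts : M t s = Some m by rewrite HM.2.1.
set c := bil M s t; set A := bform M v (alpha s); set B := bform M v (alpha t).
have D0 : (4 - c * c <> 0)%real.
  have := bil_fin mst; rewrite -/c => e.
  have := sin_pi_div m2; have := sin2_cos2 (PI / INR m); rewrite /Rsqr.
  set sn := sin _; set cs := cos _ in e *; move=> *.
  have -> : c = (- (2 * cs))%real by lra.
  by nra.
(* Cramer's rule for 2p + cq = A and cp + 2q = B: [pl] is the orthogonal projection of [v] to the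
   plane. *)
pose p := ((2 * A - c * B) / (4 - c * c))%real.
pose q := ((2 * B - c * A) / (4 - c * c))%real.
pose pl := lc p (alpha s) q (alpha t).
have fpl : finsupp pl by apply: finsupp_lc.
pose v0 := lc 1 v (- 1) pl.
have vE : v = lc 1 v0 1 pl.
  by apply: functional_extensionality => y; rewrite /v0 /lc; lra.
have fv0 : finsupp v0 by apply: finsupp_lc.
have v0s : bform M v0 (alpha s) = 0%real.
  rewrite bform_lcl // bform_lcl // !bform_alpha bil_diag // (bilC HM t) -/A -/c /p /q.
  by field.
have v0t : bform M v0 (alpha t) = 0%real.
  rewrite bform_lcl // bform_lcl // !bform_alpha bil_diag // -/B -/c /p /q.
  by field.
clearbody v0; rewrite vE /pl; clear vE.
rewrite !wact_lc // (wact_orthogonal (all_piR _ _ _) fv0 v0t v0s).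
rewrite (wact_orthogonal (all_piR _ _ _) fv0 v0s v0t).
by rewrite wact_braid_alpha // (wact_braid_alpha _ mts) // eq_sym.
Qed.

End Rank2.

(** * Elements carrying a simple root to a simple root *)

Section RootStabilizers.
Variables (S : countType) (M : S -> S -> option nat).
Hypothesis HM : coxeter_matrix M.
Implicit Types (s t r : S) (w v a : seq S) (x : word (vagen S)).
Notation "x ≡ y" := (peq (VA_rel M) x y) (at level 70).

(** The image under pi_P with signs dropped: simple reflections are involutions, so a letter and its
    inverse act alike. *)
Definition underlying x : seq S := [seq p.2 | p <- piP_word x].

Lemma underlying_cat x y : underlying (x ++ y) = underlying x ++ underlying y.
Proof. by rewrite /underlying /piP_word !map_cat. Qed.

Lemma underlying_pos (l : seq (vagen S)) :
  underlying (pos_word l) = [seq match g with Sig s => s | Tau s => s end | g <- l].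
Proof. by rewrite /underlying /piP_word /pos_word -!map_comp. Qed.

Lemma underlying_tauw w : underlying (tauw w) = w.
Proof. by rewrite underlying_pos -map_comp map_id. Qed.

Lemma wact_longest_conj s t m f : s != t -> M s t = Some m -> finsupp f ->
  wact M (piR s t m.-1 ++ [:: s]) f = wact M ((if odd m then t else s) :: piR s t m.-1) f.
Proof.
move=> st mst ff; have m2 := HM.2.2 _ _ _ st mst.
have e := wact_braid HM st mst ff.
case: m => // m in m2 mst e *; rewrite cats1 -piR_rcons e piR_cons.
by rewrite /= if_neg.
Qed.

(** Lets VA act on V through pi_P: (v1) and (v2) become the braid relation, and so does (v3) after
    regrouping its letters. *)
Lemma wact_peq x y f : x ≡ y -> finsupp f ->
  wact M (underlying x) f = wact M (underlying y) f.
Proof.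
move=> H; elim: H f => {x y}.
- by [].
- by move=> x y _ IH f ff; rewrite IH.
- by move=> x y z _ IH1 _ IH2 f ff; rewrite IH1 // IH2.
- move=> x x' y y' _ IH1 _ IH2 f ff.
  by rewrite !underlying_cat !wact_cat IH2 // IH1 //; exact: finsupp_wact.
- by move=> b [] s f ff; exact: (simple_reflK HM).
move=> x y [|[|[|]]].
- move=> [s [t [m [st [mst [-> ->]]]]]] f ff.
  by rewrite !underlying_pos !map_piR; exact: wact_braid.
- move=> [s [t [m [st [mst [-> ->]]]]]] f ff.
  by rewrite !underlying_pos !map_piR; exact: wact_braid.
- by move=> [s [-> ->]] f ff; exact: (simple_reflK HM).
move=> [s [t [m [st [mst [-> ->]]]]]] f ff.
by rewrite !underlying_pos map_cat /= !map_piR; exact: wact_longest_conj.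
Qed.

(** Equality in W, tested on the images under iota_W, so that it can be used for rewriting in VA. *)
Definition teq v w : Prop := tauw v ≡ tauw w.

Lemma tauw_cat v w : tauw (v ++ w) = tauw v ++ tauw w.
Proof. by rewrite /tauw map_cat pos_word_cat. Qed.

Lemma teq_refl w : teq w w.
Proof. exact: peq_refl. Qed.

Lemma teq_sym v w : teq v w -> teq w v.
Proof. exact: peq_sym. Qed.

Lemma teq_trans v w a : teq v w -> teq w a -> teq v a.
Proof. exact: peq_trans. Qed.

Lemma teq_cat v v' w w' : teq v v' -> teq w w' -> teq (v ++ w) (v' ++ w').
Proof. by rewrite /teq !tauw_cat; exact: peq_cat. Qed.

Lemma teq_sq s : teq [:: s; s] [::].
Proof. by apply: peq_rel; right; right; left; exists s. Qed.

Lemma teq_sq_mid v w s : teq (v ++ [:: s; s] ++ w) (v ++ w).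
Proof. exact/teq_cat/(teq_cat (teq_sq s) (teq_refl w))/teq_refl. Qed.

Lemma teq_braid s t m : s != t -> M s t = Some m -> teq (piR t s m) (piR s t m).
Proof.
move=> st mst; apply: peq_rel; right; left; exists s, t, m.
by rewrite /tauw !map_piR.
Qed.

Lemma teq_wact v w f : teq v w -> finsupp f -> wact M v f = wact M w f.
Proof. by move=> /wact_peq H /H; rewrite !underlying_tauw. Qed.

(** * Reduced words and rank two cosets *)

Definition reduced w : Prop := forall w', teq w w' -> size w <= size w'.

Definition nonshortening w s : Prop := forall w', teq (w ++ [:: s]) w' -> size w <= size w'.

(** Conjugation by w takes both sigma_s to sigma_r and tau_s to tau_r, hence also tau_s sigma_s to
    tau_r sigma_r. *)
Definition intertwines w s r : Prop :=
  forall X, X = @Sig S \/ X = @Tau S ->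
  tauw w ++ pos_word [:: X s] ≡ pos_word [:: X r] ++ tauw w.

Lemma intertwines_cat v w s t r :
  intertwines w s t -> intertwines v t r -> intertwines (v ++ w) s r.
Proof.
by move=> H1 H2 X hX; rewrite tauw_cat -catA H1 // catA H2 // catA.
Qed.

Lemma intertwines_teq v w s r : teq v w -> intertwines w s r -> intertwines v s r.
Proof. by move=> e H X hX; rewrite e H. Qed.

(** For sigma this is (v3) itself; for tau it is the braid relation with one letter split off on
    each side. *)
Lemma intertwines_longest s t m : s != t -> M s t = Some m ->
  intertwines (piR s t m.-1) s (if odd m then t else s).
Proof.
move=> st mst X [] ->.
  apply: peq_rel; right; right; right; exists s, t, m; split=> //; split=> //.
  by rewrite /tauw map_piR /pos_word map_cat.
have m2 := HM.2.2 _ _ _ st mst; have := teq_braid st mst.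
case: m => // m in m2 mst *.
rewrite [piR t s _]piR_rcons piR_cons /= if_neg -cats1 /teq tauw_cat.
by [].
Qed.

Lemma reduced_exists w : exists2 w', teq w w' & reduced w'.
Proof.
have [n] := ubnP (size w); elim: n w => // n IH w sw.
case: (classic (reduced w)) => [rw|]; first by exists w => //; exact: teq_refl.
move=> /not_all_ex_not [w1 /(@imply_to_and (teq w w1)) [e]] /negP; rewrite -ltnNge => lt.
have [w2 e2 r2] := IH w1 (leq_trans lt sw).
by exists w2 => //; exact: teq_trans e2.
Qed.

(** While s or t shortens the left factor, that letter is moved to the right factor. Since [w] is
    reduced, the lengths keep adding up to that of [w]. *)
Lemma coset_decomposition w s t v a : reduced w -> teq w (v ++ a) ->
  all (mem [:: s; t]) a -> size v + size a = size w ->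
  exists v' a', [/\ teq w (v' ++ a'), all (mem [:: s; t]) a', size v' + size a' = size w,
    size v' <= size v & nonshortening v' s /\ nonshortening v' t].
Proof.
move=> rw; have [n] := ubnP (size v); elim: n v a => // n IH v a sv e aa sz.
case: (classic (nonshortening v s /\ nonshortening v t)) => [ns|ns].
  by exists v, a; split.
have [x xst [v1 [ev lt]]] : exists2 x, x \in [:: s; t] &
    exists v1, teq (v ++ [:: x]) v1 /\ size v1 < size v.
  move: ns => /not_and_or [|] /not_all_ex_not [v1 /(@imply_to_and (teq _ v1)) [ev]];
  move=> /negP; rewrite -ltnNge => lt;
  [exists s | exists t]; rewrite ?inE ?eqxx ?orbT //; by exists v1.
have e1 : teq w (v1 ++ x :: a).
  apply: teq_trans (teq_cat ev (teq_refl (x :: a))); rewrite -catA.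
  by apply: teq_trans e _; apply: teq_sym; exact: teq_sq_mid.
have sz1 : size v1 + size (x :: a) = size w.
  apply/eqP; rewrite eqn_leq -{2}size_cat rw // andbT -sz /= addnS -addSn leq_add2r //.
have [v2 [a2 [h1 h2 h3 h4 h5]]] :=
  IH v1 (x :: a) (leq_trans lt sv) e1 (introT andP (conj xst aa)) sz1.
by exists v2, a2; split=> //; exact: leq_trans h4 (ltnW lt).
Qed.

Lemma alternating_piL s t a : all (mem [:: s; t]) a ->
  path (fun b c => b != c) s a -> a = piL t s (size a).
Proof.
elim: a s t => //= b a IH s t /andP []; rewrite !inE eq_sym => /orP [/eqP -> | /eqP -> ].
  by rewrite eqxx.
move=> aa /andP [st pa]; congr (_ :: _); apply: IH => //.
by apply: sub_all aa => y; rewrite !inE orbC.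
Qed.

Lemma alternating_piR s t a : s != t -> all (mem [:: s; t]) a ->
  (forall l1 l2 (x : S), a <> l1 ++ x :: x :: l2) -> (forall l, a <> rcons l s) ->
  a = piR s t (size a).
Proof.
move=> st aa sq ends.
rewrite -[LHS]revK /piR -(size_rev a); congr rev; apply: alternating_piL.
  by rewrite all_rev.
have sq' l1 l2 (x : S) : rev a <> l1 ++ x :: x :: l2.
  move=> e; apply: (sq (rev l2) (rev l1) x).
  by rewrite -[a]revK e rev_cat !rev_cons -!cats1 -!catA.
have ends' l : rev a <> s :: l.
  by move=> e; apply: (ends (rev l)); rewrite -[a]revK e rev_cons.
case: (rev a) sq' ends' => //= b l sq' ends'; apply/andP; split.
  by apply/eqP => e; apply: (ends' l); rewrite e.
elim: l b sq' {ends'} => //= c l IH b sq'; apply/andP; split.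
  by apply/eqP => e; apply: (sq' [::] l b); rewrite e.
by apply: IH => l1 l2 x e; apply: (sq' (b :: l1) l2 x); rewrite e.
Qed.

Lemma piR_suffix s t m k : m <= k -> exists2 l, piR s t k = l ++ piR s t m & size l = k - m.
Proof.
elim: k => [|k IH]; first by rewrite leqn0 => /eqP ->; exists [::].
rewrite leq_eqVlt => /orP [/eqP -> |]; first by exists [::] => //; rewrite subnn.
rewrite ltnS => mk; have [l e sl] := IH mk.
exists ((if odd k then s else t) :: l); first by rewrite piR_cons e.
by rewrite /= sl subSn.
Qed.

(** * Positivity of roots *)

Definition nonneg (f : S -> R) : Prop := forall t, (0 <= f t)%real.

Lemma nonneg_alpha s : nonneg (alpha s).
Proof. by move=> t; rewrite /alpha; case: eqP => _; lra. Qed.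

(** The coefficients are quotients of sines of angles below pi, except that the second one vanishes
    for k = m - 1. *)
Lemma rank2_coefs s t k : s != t -> 0 < k -> (forall m, M s t = Some m -> k < m) ->
  (0 < cheb (- bil M s t) k)%real /\
  ((0 < cheb (- bil M s t) k.+1)%real \/ M s t = Some k.+1).
Proof.
move=> st k0; case mst: (M s t) => [m|] km.
  have m2 := HM.2.2 _ _ _ st mst; have {}km := km m erefl.
  rewrite (bil_fin mst); split; first exact: cheb_gt0.
  move: km; rewrite leq_eqVlt => /orP [/eqP <- | km]; first by right.
  by left; apply: cheb_gt0.
have -> : (- bil M s t = 2)%real by rewrite /bil mst; lra.
by rewrite !cheb2; split; [|left]; apply: lt_0_INR; apply/ltP.
Qed.

(** Without cancellation both w a_s and w a_t would have to be multiples of a_r, but they are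
    linearly independent. *)
Lemma no_nonneg_combination w s t r p q : s != t -> (0 < p)%real -> (0 < q)%real ->
  nonneg (wact M w (alpha s)) -> nonneg (wact M w (alpha t)) ->
  wact M w (lc p (alpha s) q (alpha t)) <> alpha r.
Proof.
move=> st p0 q0 ns nt; rewrite wact_lc //.
set f := wact M w (alpha s) in ns *; set g := wact M w (alpha t) in nt *.
move=> e.
have ey y : (p * f y + q * g y = alpha r y)%real by rewrite -e.
have off y : y != r -> f y = 0%real /\ g y = 0%real.
  move=> yr; have := ey y; rewrite alpha_off 1?eq_sym //.
  by have := ns y; have := nt y; split; nra.
(* From f = f(r) a_r and g = g(r) a_r follows the dependence g(r) f - f(r) g = 0, which forces f(r)
   = g(r) = 0. *)
have Z : wact M w (lc (g r) (alpha s) (- f r) (alpha t)) =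
         wact M w (lc 0 (alpha s) 0 (alpha t)).
  rewrite !wact_lc // -/f -/g; apply: functional_extensionality => y; rewrite /lc.
  case: (eqVneq y r) => [->|/off [-> ->]]; lra.
move/(wact_inj HM): Z => Z.
have {}Z : lc (g r) (alpha s) (- f r) (alpha t) = lc 0 (alpha s) 0 (alpha t) by apply: Z; auto.
have := f_equal (fun h => h s) Z; have := f_equal (fun h => h t) Z.
rewrite /lc !alpha_diag !(alpha_off st) !(@alpha_off _ t s) 1?eq_sym //.
by have := ey r; rewrite alpha_diag; nra.
Qed.

(* Humphreys' proof that l(ws) > l(w) forces w a_s > 0, carrying along the
   decomposition of the elements which send a simple root to a simple root. *)
Lemma nonneg_and_intertwines w s : reduced w -> nonshortening w s ->
  nonneg (wact M w (alpha s)) /\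
  forall r, wact M w (alpha s) = alpha r -> intertwines w s r.
Proof.
have [n] := ubnP (size w); elim: n w s => // n IH w s.
case/lastP: w => [|w0 t] sw rw nw.
  split=> [|r /alpha_inj <- X hX]; first exact: nonneg_alpha.
  exact: peq_refl.
(* Otherwise ws would be represented by the shorter word [w0]. *)
have st : s != t.
  apply/eqP => e; have := nw w0; rewrite size_rcons ltnn => H.
  suff: false by []; apply: H; rewrite -e -cats1 -catA /=.
  by have := teq_sq_mid w0 [::] s; rewrite !cats0.
have [|||v [a [e aa sz sv [nvs nvt]]]] :=
    @coset_decomposition (rcons w0 t) s t w0 [:: t] rw.
- by rewrite cats1; exact: teq_refl.
- by rewrite /= !inE eqxx orbT.
- by rewrite size_rcons addn1.
set w := rcons w0 t in sw rw nw e sz *.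
have ts : t != s by rewrite eq_sym.
have svw : size v < size w by rewrite size_rcons.
have short l : teq (w ++ [:: s]) (v ++ l) -> size a <= size l.
  by move=> /nw; rewrite -sz size_cat leq_add2l.
have rv : reduced v.
  move=> v' ev; have := rw (v' ++ a) (teq_trans e (teq_cat ev (teq_refl a))).
  by rewrite size_cat -sz leq_add2r.
have ns_last l : teq a (l ++ [:: s]) -> size a <= size l.
  move=> el; apply: short.
  apply: teq_trans (teq_cat (teq_trans e (teq_cat (teq_refl v) el)) (teq_refl [:: s])) _.
  by have := teq_sq_mid (v ++ l) [::] s; rewrite !cats0 -!catA.
(* A repeated letter in [a] would shorten [w], and a final s would shorten ws; so [a] alternates and
   ends with t. *)
have aE : a = piR s t (size a).
  apply: alternating_piR => // [l1 l2 x ea | l ea].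
    have : teq w (v ++ l1 ++ l2).
      apply: teq_trans e _; apply: teq_cat (teq_refl v) _.
      by rewrite ea; exact: teq_sq_mid.
    move/rw; rewrite -sz ea !size_cat /= leq_add2l leq_add2l.
    by rewrite ltnNge leqnSn.
  have := ns_last l; rewrite ea size_rcons ltnn cats1 => H.
  by suff: false by []; apply: H; exact: teq_refl.
have a0 : 0 < size a by move: svw; rewrite -sz -{1}[size v]addn0 ltn_add2l.
(* A longer [a] would have a suffix of length m, which the braid relation turns into one ending with
   s. *)
have am m : M s t = Some m -> size a < m.
  move=> mst; have m2 := HM.2.2 _ _ _ st mst.
  rewrite ltnNge; apply/negP => ma.
  have [l el sl] := piR_suffix s t ma.
  have : teq a (l ++ piR s t m.-1 ++ [:: s]).
    rewrite aE el; apply: teq_cat (teq_refl l) _; apply: teq_sym.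
    by have := teq_braid st mst; rewrite -{1}(prednK (ltnW m2)) piR_rcons -cats1.
  rewrite catA => /ns_last; rewrite size_cat size_piR sl.
  rewrite leqNgt => /negP; apply.
  by rewrite -{2}(subnK ma) ltn_add2l prednK // ltnW.
have {}sv : size v < n := leq_trans svw sw.
have [ps is_] := IH v s sv rv nvs; have [pt it] := IH v t sv rv nvt.
have we : wact M w (alpha s) = wact M v (wact M a (alpha s)).
  by rewrite (teq_wact e) // wact_cat.
(* Either w a_s is a strictly positive combination of v a_s and v a_t, so it is not simple, or [a]
   has length m - 1 and carries a_s to a simple root, which leaves the induction hypothesis for
   [v]. *)
rewrite we; case: (rank2_coefs st a0 am) => q0 [p0|mst].
  rewrite aE wact_rank2 //; case: (odd (size a)); split.
  - by move=> y; rewrite wact_lc // /lc; have := ps y; have := pt y; nra.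
  - by move=> r er; case: (no_nonneg_combination ts p0 q0 pt ps er).
  - by move=> y; rewrite wact_lc // /lc; have := ps y; have := pt y; nra.
  - by move=> r er; case: (no_nonneg_combination st p0 q0 ps pt er).
have L := wact_longest HM st mst; have I := intertwines_longest st mst.
rewrite [_.-1]/= -aE in L I; rewrite L.
split=> [|r]; first by case: (odd _).
move=> er; apply: intertwines_teq e _; apply: intertwines_cat I _.
by move: er; case: (odd _); [exact: it | exact: is_].
Qed.

(** If ws were shorter than w, positivity for ws would make ws a_s = -w a_s = -a_r nonnegative. *)
Lemma wact_alpha_intertwines w s r : wact M w (alpha s) = alpha r -> intertwines w s r.
Proof.
have [w0 e0 r0] := reduced_exists w.
rewrite (teq_wact e0) // => er; apply: intertwines_teq e0 _.
case: (classic (nonshortening w0 s)) => [n0|].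
  by apply: (nonneg_and_intertwines r0 n0).2.
move=> /not_all_ex_not [w1 /(@imply_to_and (teq _ w1)) [e1]] /negP; rewrite -ltnNge => lt.
have [w2 e2 r2] := reduced_exists w1.
have e3 : teq (w0 ++ [:: s]) w2 := teq_trans e1 e2.
have n2 : nonshortening w2 s.
  move=> w3 e4; apply: leq_trans (r2 _ (teq_sym e2)) (leq_trans (ltnW lt) (r0 _ _)).
  apply: teq_trans e4; apply: teq_trans (teq_cat e3 (teq_refl [:: s])).
  by rewrite -catA; apply: teq_sym; have := teq_sq_mid w0 [::] s; rewrite !cats0.
have [/(_ r) p2 _] := nonneg_and_intertwines r2 n2.
exfalso; move: p2; rewrite -(teq_wact e3) // wact_cat /= refl_alpha_self //.
have -> : (fun t => - alpha s t)%real = lc (- 1) (alpha s) 0 (alpha s).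
  by apply: functional_extensionality => y; rewrite /lc; lra.
by rewrite wact_lc // er /lc alpha_diag; lra.
Qed.

End RootStabilizers.

(** * The action on roots and the cocycle *)

Section RootAction.
Variables (S : countType) (M : S -> S -> option nat).
Hypothesis HM : coxeter_matrix M.
Implicit Types (s t r : S) (v w : seq S) (x y : word (vagen S)) (b g : Phi M) (u : word (Phi M)).
Notation "x ≡ y" := (peq (VA_rel M) x y) (at level 70).
Notation "u ≃ v" := (peq (@hat_rel S M) u v) (at level 70).

Lemma Phi_inj b g : proj1_sig b = proj1_sig g -> b = g.
Proof. by case: b g => [f hf] [h hh] /= e; subst h; congr exist; exact: proof_irrelevance. Qed.

Lemma finsupp_root b : finsupp (proj1_sig b).
Proof. by case: b => f [[w s] /= ->]; auto. Qed.
Hint Resolve finsupp_root : core.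

Definition rt w s : Phi M := exist _ (wact M w (alpha s)) (ex_intro _ (w, s) erefl).

Lemma is_root_wact w b : is_root M (wact M w (proj1_sig b)).
Proof. by case: b => f [[v s] /= ->]; exists (w ++ v, s); rewrite wact_cat. Qed.

Definition act w b : Phi M := exist _ (wact M w (proj1_sig b)) (is_root_wact w b).

Definition actl w u : word (Phi M) := map (fun p => (p.1, act w p.2)) u.

Lemma act_cat v w b : act (v ++ w) b = act v (act w b).
Proof. by apply: Phi_inj; rewrite /= wact_cat. Qed.

Lemma act_rt v w s : act v (rt w s) = rt (v ++ w) s.
Proof. by apply: Phi_inj; rewrite /= wact_cat. Qed.

Lemma act0 b : act [::] b = b.
Proof. exact: Phi_inj. Qed.

Lemma act_sq s b : act [:: s; s] b = b.
Proof. by apply: Phi_inj; rewrite /= (simple_reflK HM). Qed.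

Lemma act_ext v w : (forall f, finsupp f -> wact M v f = wact M w f) -> act v =1 act w.
Proof. by move=> e b; apply: Phi_inj; rewrite /= e. Qed.

Lemma actl_ext v w : act v =1 act w -> actl v =1 actl w.
Proof. by move=> e u; apply: eq_map => p; rewrite e. Qed.

Lemma actl_comp v w u : actl v (actl w u) = actl (v ++ w) u.
Proof. by rewrite /actl -map_comp; apply: eq_map => p /=; rewrite act_cat. Qed.

Lemma actl_id w u : act w =1 id -> actl w u = u.
Proof. by move=> e; rewrite -[RHS]map_id; apply: eq_map => -[c b] /=; rewrite e. Qed.

Lemma actl0 u : actl [::] u = u.
Proof. exact/actl_id/act0. Qed.

Lemma actl_cat w u1 u2 : actl w (u1 ++ u2) = actl w u1 ++ actl w u2.
Proof. exact: map_cat. Qed.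

Lemma actl_pos w (l : seq (Phi M)) : actl w (pos_word l) = pos_word (map (act w) l).
Proof. by rewrite /actl /pos_word -!map_comp. Qed.

(** * The elements zeta *)

Lemma winv_tauw w : winv (tauw w) ≡ tauw (rev w).
Proof.
symmetry; apply: peq_winvP; elim: w => [|s w IH]; first exact: peq_refl.
rewrite rev_cons -cats1 -[s :: w]cat1s !tauw_cat -catA (catA (tauw w)) IH.
exact: (teq_sq M s).
Qed.

Lemma tau_inv s : [:: (true, Tau s)] ≡ tauw [:: s].
Proof. exact: (winv_tauw [:: s]). Qed.

(** If [epsilon] has picked (v, t), then w^{-1} v carries a_t to a_s, so it intertwines tau_t
    sigma_t with tau_s sigma_s. *)
Lemma zeta_rt w s f : f = wact M w (alpha s) ->
  zeta M f ≡ tauw w ++ pos_word [:: Tau s; Sig s] ++ winv (tauw w).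
Proof.
move=> ef; rewrite /zeta.
have := epsilon_spec (inhabits None)
  (fun o => match o with Some ws => f = wact M ws.1 (alpha ws.2) | None => False end)
  (ex_intro _ (Some (w, s)) ef).
rewrite -/(root_rep M f); case: (root_rep M f) => // -[v t] ev.
rewrite -[X in X ≡ _]/(tauw v ++ pos_word [:: Tau t; Sig t] ++ winv (tauw v)).
change (f = wact M v (alpha t)) in ev.
have I : intertwines M (rev w ++ v) t s.
  by apply: (wact_alpha_intertwines HM); rewrite wact_cat -ev ef (wact_revK HM).
have I2 : tauw (rev w ++ v) ++ pos_word [:: Tau t; Sig t] ≡
          pos_word [:: Tau s; Sig s] ++ tauw (rev w ++ v).
  have split2 r : pos_word [:: Tau r; Sig r] = pos_word [:: Tau r] ++ pos_word [:: Sig r] by [].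
  rewrite !split2 catA (I (@Tau S)); last by right.
  by rewrite -!catA (I (@Sig S)); last by left.
apply: (@peq_cancel_r _ _ (tauw v)); apply: (@peq_cancel_l _ _ (tauw (rev w))).
rewrite -!catA (peq_Vmul _ (tauw v)) cats0 catA -tauw_cat I2.
by rewrite tauw_cat -(winv_tauw w) peq_mulVK.
Qed.

Lemma zeta_act w b :
  zeta M (proj1_sig (act w b)) ≡ tauw w ++ zeta M (proj1_sig b) ++ winv (tauw w).
Proof.
case: b => f [[v s] /= ef]; rewrite (@zeta_rt (w ++ v) s) ?wact_cat ?ef //.
by rewrite (@zeta_rt v s) // tauw_cat winv_cat -!catA.
Qed.

Lemma hatmap_cons c b u : hatmap ((c, b) :: u) =
  (if c then winv (zeta M (proj1_sig b)) else zeta M (proj1_sig b)) ++ hatmap u.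
Proof. by []. Qed.

Lemma hatmap_cat u1 u2 : hatmap (u1 ++ u2) = hatmap u1 ++ hatmap u2.
Proof. by rewrite /hatmap map_cat flatten_cat. Qed.

Lemma hatmap_act w u : hatmap (actl w u) ≡ tauw w ++ hatmap u ++ winv (tauw w).
Proof.
elim: u => [|[c b] u IH]; first by rewrite /= peq_mulV.
rewrite [actl _ _]/= !hatmap_cons IH; case: c.
  rewrite (peq_winv (zeta_act w b)) !winv_cat winvK -!catA.
  by rewrite (peq_mulVK _ (tauw w)).
by rewrite zeta_act -!catA (peq_mulVK _ (tauw w)).
Qed.

(* the roots a_x, x a_y, xy a_z, and so on, attached to a word xyz... *)
Fixpoint Zs (X : seq S) : seq (Phi M) :=
  if X is s :: X' then rt [::] s :: map (act [:: s]) (Zs X') else [::].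

(** The tail contributes its own value conjugated by tau_s, and the tau_s on the right cancels
    against the first letter of zeta_{a_s} = tau_s sigma_s. *)
Lemma hatmap_Zs X : hatmap (pos_word (rev (Zs X))) ≡ tauw X ++ pos_word (map (@Sig S) (rev X)).
Proof.
elim: X => [|s X IH]; first exact: peq_refl.
have hs : hatmap (pos_word [:: rt [::] s]) ≡ tauw [:: s] ++ pos_word [:: Sig s].
  by rewrite hatmap_cons cats0 (@zeta_rt [::] s).
have ss : tauw [:: s] ++ tauw [:: s] ≡ [::] := teq_sq M s.
rewrite [Zs _]/= !rev_cons -!cats1 pos_word_cat hatmap_cat -map_rev -actl_pos hatmap_act IH hs.
rewrite map_cat pos_word_cat -[s :: X]cat1s tauw_cat (winv_tauw [:: s]) -!catA.
by rewrite (catA (tauw (rev _))) ss.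
Qed.

(** * The relations of hat PVA as translates from simple roots *)

Lemma Zs_piL s t m : map (@proj1_sig _ _) (Zs (piL s t m)) =
  [seq wact M (piL s t i) (alpha (if odd i then t else s)) | i <- iota 0 m].
Proof.
elim: m s t => //= m IH s t; congr (_ :: _).
have -> : iota 1 m = map (addn 1) (iota 0 m) by rewrite -iotaDl.
rewrite -!map_comp (eq_map (_ : _ =1 refl M (alpha s) \o @proj1_sig _ _)) //.
rewrite map_comp IH -map_comp; apply: eq_map => i /=.
by case: (odd i).
Qed.

Lemma applyseq_piL (f g h : S -> R) w s t i : finsupp h ->
  f = wact M w (alpha s) -> g = wact M w (alpha t) ->
  applyseq (piL (refl M f) (refl M g) i) (wact M w h) = wact M w (wact M (piL s t i) h).
Proof.
move=> fh -> ->; elim: i s t => //= i IH s t.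
by rewrite IH (refl_wact HM); auto.
Qed.

(** For either parity of k the product in the definition of beta_k begins with r_beta, so the two
    branches merge into one [piL]. The shift is due to k starting at 1. *)
Lemma betakE w s t i :
  betak M (wact M w (alpha t)) (wact M w (alpha s)) i.+1 =
  wact M w (wact M (piL s t i) (alpha (if odd i then t else s))).
Proof.
rewrite /betak /= !piRE; case: (odd i) => /=; exact: applyseq_piL.
Qed.

Lemma Zletters_Zs w s t m :
  Zletters M (wact M w (alpha t)) (wact M w (alpha s)) m =
  map (@proj1_sig _ _) (map (act w) (rev (Zs (piL s t m)))).
Proof.
rewrite /Zletters !map_rev; congr rev.
rewrite -map_comp (eq_map (_ : _ =1 wact M w \o @proj1_sig _ _)) // map_comp Zs_piL.
have -> : iota 1 m = map (addn 1) (iota 0 m) by rewrite -iotaDl.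
by rewrite -!map_comp; apply: eq_map => i /=; exact: betakE.
Qed.

Lemma map_proj1_inj (u1 u2 : word (Phi M)) :
  map (fun p => (p.1, proj1_sig p.2)) u1 = map (fun p => (p.1, proj1_sig p.2)) u2 -> u1 = u2.
Proof.
elim: u1 u2 => [|[c b] u1 IH] [|[d g] u2] //= [-> /Phi_inj -> /IH ->] //.
Qed.

(** The word Z(w a_t, w a_s, m); note the order of the two roots. *)
Definition Zword w s t m : word (Phi M) := actl w (pos_word (rev (Zs (piL s t m)))).

Lemma map_proj1_Zword w s t m :
  map (fun p => (p.1, proj1_sig p.2)) (Zword w s t m) =
  pos_word (Zletters M (wact M w (alpha t)) (wact M w (alpha s)) m).
Proof. by rewrite Zletters_Zs /Zword actl_pos /pos_word -!map_comp. Qed.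

Lemma hat_relP u1 u2 : hat_rel u1 u2 <-> exists w s t m,
  s != t /\ M s t = Some m /\ u1 = Zword w s t m /\ u2 = Zword w t s m.
Proof.
split=> [[b [g [m [bg [[w [s [t [eb [eg mst]]]]] [e1 e2]]]]]]|[w [s [t [m [st [mst [-> ->]]]]]]]].
  exists w, s, t, m; split; first by apply/eqP => e; apply: bg; rewrite eb eg e.
  by split=> //; split; apply: map_proj1_inj; rewrite map_proj1_Zword -eb -eg.
exists (rt w s), (rt w t), m; split.
  move=> /= /(wact_inj HM) e; move/eqP: st; apply; apply: alpha_inj; apply: e; auto.
by split; [exists w, s, t | rewrite !map_proj1_Zword].
Qed.

(** By [hatmap_Zs] each side of a relation is a conjugate of a tau-word times a sigma-word; (v2)
    matches the former and (v1) the latter. *)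
Lemma hatmap_peq u1 u2 : u1 ≃ u2 -> hatmap u1 ≡ hatmap u2.
Proof.
elim=> {u1 u2} [u|u1 u2 _ ->|u1 u2 u3 _ -> _ ->|u1 u2 v1 v2 _ e1 _ e2|c b|u1 u2] //.
- by rewrite !hatmap_cat e1 e2.
- by rewrite /hatmap /=; case: c; rewrite /= cats0 ?peq_mulV ?peq_Vmul.
move=> /hat_relP [w [s [t [m [st [mst [-> ->]]]]]]].
rewrite /Zword !hatmap_act !hatmap_Zs -!/(piR _ _ _) !map_piR.
have -> : pos_word (piR (Sig t) (Sig s) m) ≡ pos_word (piR (Sig s) (Sig t) m).
  by apply: peq_rel; left; exists s, t, m.
have -> // : tauw (piL s t m) ≡ tauw (piL t s m).
have := teq_braid st mst; rewrite /teq !piRE; case: (odd m) => //.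
exact: peq_sym.
Qed.

Lemma actl_peq w u1 u2 : u1 ≃ u2 -> actl w u1 ≃ actl w u2.
Proof.
elim=> {u1 u2} [u|u1 u2 _ ->|u1 u2 u3 _ -> _ ->|u1 u2 v1 v2 _ e1 _ e2|c b|u1 u2] //.
- by rewrite !actl_cat e1 e2.
- exact: peq_free.
move=> /hat_relP [v [s [t [m [st [mst [-> ->]]]]]]].
by apply: peq_rel; apply/hat_relP; exists (w ++ v), s, t, m; rewrite /Zword !actl_comp.
Qed.

(* The component in hat PVA of the morphism VA -> hat PVA x| W sending tau_s to (1, s)
   and sigma_s to (hat zeta of -a_s, s); [rt [:: s] s] is the root -a_s. *)
Fixpoint cocycle x : word (Phi M) :=
  match x with
  | [::] => [::]
  | (_, Tau s) :: x' => actl [:: s] (cocycle x')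
  | (c, Sig s) :: x' => (c, rt (if c then [::] else [:: s]) s) :: actl [:: s] (cocycle x')
  end.

(** * Properties of the cocycle *)

Lemma cocycle_cat x y : cocycle (x ++ y) = cocycle x ++ actl (underlying x) (cocycle y).
Proof.
elim: x => [|[c [] s] x IH] /=; first by rewrite actl0.
  by rewrite IH actl_cat actl_comp.
by rewrite IH actl_cat actl_comp.
Qed.

Lemma cocycle_tauw w : cocycle (tauw w) = [::].
Proof. by elim: w => //= s w ->. Qed.

(** Translation by the whole word cancels the s in front of the tail of [Zs] and turns its head a_s
    into the root contributed by the last sigma_s. *)
Lemma cocycle_piR_Sig X :
  cocycle (pos_word (map (@Sig S) (rev X))) = actl (rev X) (pos_word (rev (Zs X))).
Proof.
elim: X => // s X IH.
rewrite [Zs _]/= !rev_cons -!cats1 map_cat !pos_word_cat cocycle_cat IH.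
rewrite underlying_pos -map_comp map_id actl_cat; congr (_ ++ _).
  rewrite !actl_pos -map_rev -map_comp; congr pos_word; apply: eq_map => b /=.
  by rewrite -act_cat -catA act_cat act_sq.
by rewrite /= !act_rt cats0.
Qed.

Lemma act_underlying x y : x ≡ y -> act (underlying x) =1 act (underlying y).
Proof. by move=> e; apply: act_ext => f; exact: (wact_peq HM). Qed.

Lemma cocycle_peq x y : x ≡ y -> cocycle x ≃ cocycle y.
Proof.
elim=> {x y} [x|x y _ ->|x y z _ -> _ ->|x y x' y' e1 IH1 e2 IH2|c [] s|x y] //.
- by rewrite !cocycle_cat IH1 (actl_peq _ IH2) (actl_ext (act_underlying e1)).
- rewrite /= act_rt.
  (* The inverse of (hat zeta_{-a_s}, s) is (hat zeta_{a_s}^{-1}, s), so an inverse letter carries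
     a_s; the translation by s makes the two roots agree. *)
  have -> : rt ([:: s] ++ (if ~~ c then [::] else [:: s])) s = rt (if c then [::] else [:: s]) s.
    by case: c => //=; apply: Phi_inj; rewrite /= (simple_reflK HM).
  exact: peq_free.
case=> [|[|[|]]].
- move=> [s [t [m [st [mst [-> ->]]]]]].
  rewrite -!map_piR !cocycle_piR_Sig -!/(piR _ _ _).
  (* The two words of (v1) act alike on roots, so both cocycles are Z-words translated by the same
     element. *)
  have -> : actl (piR s t m) (pos_word (rev (Zs (piL t s m)))) =
            actl (piR t s m) (pos_word (rev (Zs (piL t s m)))).
    by apply: actl_ext; apply: act_ext => f ff; rewrite (wact_braid HM st mst).
  by apply: peq_rel; apply/hat_relP; exists (piR t s m), s, t, m.
- move=> [s [t [m [st [mst [-> ->]]]]]].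
  by rewrite -!map_piR -!/(tauw _) !cocycle_tauw.
- by move=> [s [-> ->]].
move=> [s [t [m [st [mst [-> ->]]]]]].
have tE : pos_word (piR (Tau s) (Tau t) m.-1) = tauw (piR s t m.-1) by rewrite /tauw map_piR.
rewrite pos_word_cat tE cocycle_cat cocycle_tauw underlying_tauw /= act_rt.
rewrite tE cocycle_tauw.
(* In (v3) only the sigmas contribute: Pi_R(s, t, m - 1) carries -a_s to -a_r. *)
have -> : rt (piR s t m.-1 ++ [:: s]) s = rt [:: if odd m then t else s] (if odd m then t else s).
  by apply: Phi_inj; rewrite /= (wact_longest_conj HM st mst) //= (wact_longest HM st mst).
exact: peq_refl.
Qed.

Lemma act_zeta b : act (underlying (zeta M (proj1_sig b))) =1 id.
Proof.
case: b => f [[w s] /= ef] b.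
have e : zeta M f ≡ tauw w ++ pos_word [:: Tau s; Sig s] ++ tauw (rev w).
  by rewrite (zeta_rt ef) winv_tauw.
rewrite (act_underlying e) !underlying_cat !underlying_tauw underlying_pos /= act_cat.
by rewrite (act_cat [:: s; s]) act_sq; apply: Phi_inj; rewrite /= (wactK HM).
Qed.

(** The only sigma_s comes after w and tau_s, and ws(-a_s) = w a_s. *)
Lemma cocycle_zeta b : cocycle (zeta M (proj1_sig b)) ≃ [:: (false, b)].
Proof.
case: b => f [[w s] /= ef].
have e : zeta M f ≡ tauw w ++ pos_word [:: Tau s; Sig s] ++ tauw (rev w).
  by rewrite (zeta_rt ef) winv_tauw.
rewrite (cocycle_peq e) !cocycle_cat !cocycle_tauw underlying_tauw /= !act_rt.
have -> // : rt (w ++ [:: s] ++ [:: s]) s = exist _ f (ex_intro _ (w, s) ef).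
by apply: Phi_inj; rewrite /= wact_cat /= (simple_reflK HM).
Qed.

Lemma cocycle_winv x : act (underlying x) =1 id -> cocycle (winv x) ≃ winv (cocycle x).
Proof.
move=> ax; apply: peq_winvP; have := cocycle_peq (peq_mulV (VA_rel M) x).
by rewrite cocycle_cat actl_id.
Qed.

(** The cocycle is multiplicative on words acting trivially on the roots, so single letters
    suffice. *)
Lemma cocycle_hatmap u : cocycle (hatmap u) ≃ u.
Proof.
elim: u => [|[c b] u IH] //; rewrite hatmap_cons cocycle_cat.
have az := act_zeta b.
case: c; last by rewrite actl_id // cocycle_zeta IH.
rewrite (cocycle_winv az) (peq_winv (cocycle_zeta b)) actl_id ?IH // => g.
rewrite -[LHS]az -act_cat -underlying_cat (act_underlying (peq_mulV _ _)).
exact: act0.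
Qed.

(** The factorization of VA over iota_W(W). For a letter sigma_s it rests on zeta_{-a_s} = tau_s
    (tau_s sigma_s) tau_s = sigma_s tau_s. *)
Lemma hatmap_cocycle x : x ≡ hatmap (cocycle x) ++ tauw (underlying x).
Proof.
elim: x => [|[c g] x IH] //.
have ss s y : tauw [:: s] ++ tauw [:: s] ++ y ≡ y.
  by rewrite catA; have -> : tauw [:: s] ++ tauw [:: s] ≡ [::] := teq_sq M s.
have conj s : hatmap (actl [:: s] (cocycle x)) ++ tauw (s :: underlying x) ≡ tauw [:: s] ++ x.
  rewrite hatmap_act -[s :: _]cat1s (tauw_cat [:: s] (underlying x)) winv_tauw -!catA ss.
  by rewrite -IH.
case: g => s; last first.
  rewrite [cocycle _]/= conj -[_ :: x]cat1s; case: c => //.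
  by rewrite tau_inv.
rewrite [cocycle _]/= hatmap_cons -catA conj -[_ :: x]cat1s; case: c.
  rewrite (peq_winv (@zeta_rt [::] s (alpha s) erefl)) cats0.
  rewrite -[winv _]/([:: (true, Sig s)] ++ [:: (true, Tau s)]) tau_inv -catA ss.
  by [].
rewrite (@zeta_rt [:: s] s) // winv_tauw -!catA ss.
by rewrite -[rev _]/[:: s] ss.
Qed.

(** * Membership in PVA *)

Lemma tau_peq (a c : word S) : peq (coxW_rel M) a c ->
  map (fun p => (p.1, Tau p.2)) a ≡ map (fun p => (p.1, Tau p.2)) c.
Proof.
elim=> {a c} [a|a c _ ->|a c d _ -> _ ->|a c a' c' _ e1 _ e2|c s|a c] //.
- by rewrite !map_cat e1 e2.
- exact: peq_free.
case=> [[s [-> ->]]|[s [t [m [st [mst [-> ->]]]]]]].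
  exact: (teq_sq M s).
by have := teq_braid st mst; rewrite /teq /tauw /pos_word -!map_comp.
Qed.

Lemma tau_piP x : map (fun p => (p.1, Tau p.2)) (piP_word x) ≡ tauw (underlying x).
Proof.
elim: x => [|[c g] x IH] //=; rewrite -cat1s (tauw_cat [:: _] (underlying x)) IH.
by case: c; rewrite ?tau_inv.
Qed.

Lemma inPVA_cat x y : inPVA M x -> inPVA M y -> inPVA M (x ++ y).
Proof. by rewrite /inPVA /piP_word map_cat => -> ->. Qed.

Lemma piP_winv x : piP_word (winv x) = winv (piP_word x).
Proof. by rewrite /piP_word /winv !map_rev -!map_comp. Qed.

Lemma inPVA_winv x : inPVA M x -> inPVA M (winv x).
Proof. by move=> h; rewrite /inPVA piP_winv (peq_winv h). Qed.

Lemma inPVA_zeta f : inPVA M (zeta M f).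
Proof.
rewrite /zeta; case: (root_rep M f) => [[w s]|] //.
rewrite /inPVA {1}/piP_word !map_cat -!/(piP_word _) piP_winv.
have -> : piP_word (pos_word [:: Tau s; Sig s]) = pos_word [:: s; s] by [].
have -> : peq (coxW_rel M) (pos_word [:: s; s]) [::] by apply: peq_rel; left; exists s.
exact: peq_mulV.
Qed.

Lemma inPVA_hatmap u : inPVA M (hatmap u).
Proof.
elim: u => [|[c b] u IH] //; rewrite hatmap_cons; apply: inPVA_cat => //.
by case: c; [apply: inPVA_winv|]; exact: inPVA_zeta.
Qed.

Lemma tauw_underlying x : inPVA M x -> tauw (underlying x) ≡ [::].
Proof. by move=> /tau_peq; rewrite tau_piP. Qed.

End RootAction.

Theorem theorem2p6 (S : countType) (M : S -> S -> option nat) (HM : coxeter_matrix M) :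
  (* well defined: the relations of hat PVA are sent to relations of VA *)
  (forall u v : word (Phi M), peq (@hat_rel S M) u v -> peq (VA_rel M) (hatmap u) (hatmap v)) /\
  (* injective *)
  (forall u v : word (Phi M), peq (VA_rel M) (hatmap u) (hatmap v) -> peq (@hat_rel S M) u v) /\
  (* lands in PVA *)
  (forall u : word (Phi M), inPVA M (hatmap u)) /\
  (* onto PVA *)
  (forall x : word (vagen S), inPVA M x -> exists u : word (Phi M), peq (VA_rel M) (hatmap u) x).
Proof.
split; [|split; [|split]].
- exact: hatmap_peq.
- by move=> u v /(cocycle_peq HM); rewrite !cocycle_hatmap.
- exact: inPVA_hatmap.
(* For [x] in PVA the factor from iota_W(W) is trivial. *)
by move=> x /tauw_underlying tx; exists (cocycle M x); rewrite {2}(hatmap_cocycle HM x) tx cats0.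
Qed.
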